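(* Let $K$ be a field of characteristic zero, let $n\ge 2$, let $S=K[X_1,\dots,X_n]$, and let $a_i,b_i,c_i$ ($1\le i\le n$) and $m$ be non-negative integers. For a nonzero homogeneous polynomial $F\in S$ let $A_F$ denote the Artinian Gorenstein algebra with Macaulay dual generator $F$. In each item below, $F$ is assumed to be nonzero. (1) If $F=X_1^{a_1}\cdots X_n^{a_n}\,(X_1^{b_1}\cdots X_r^{b_r}-X_{r+1}^{b_{r+1}}\cdots X_n^{b_n})$ for some $1\le r\le n-1$ is homogeneous, i.e. $b_1+\cdots+b_r=b_{r+1}+\cdots+b_n$, and the inequality $a_1>a_2+\cdots+a_n+b_{r+1}+\cdots+b_n$ holds, then $A_F$ satisfies the weak Lefschetz property. (2) If $F=X_i^{a_i}\,(X_1^{b_1}-X_2^{b_2}X_3^{b_3}\cdots X_n^{b_n})$ for some $1\le i\le n$, with $\sum_{j=2}^n b_j=b_1$, then $A_F$ has the weak Lefschetz property. (3) If $F=X_1^{c_1}X_2^{c_2}X_3^{c_3}\cdots X_n^{c_n}\,(X_1^m-X_2^m)$, then $A_F$ has the strong Lefschetz property. (4) If $n\ge 3$ and $F=X_1^{c_1}X_2^{c_2}X_3^{c_3}\cdots X_n^{c_n}\,(m_1-m_2)$, where $m_1$ and $m_2$ are monomials of the same degree in three variables $X_i,X_j,X_r$, then $A_F$ has the strong Lefschetz property.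
   Context: Let $S=K[X_1,\dots,X_n]$ and $R=K[x_1,\dots,x_n]$, both standard graded, where $R$ acts on $S$ by differentiation: for $p\in R$ and $G\in S$, $p\circ G$ is the result of applying the differential operator $p(\partial/\partial X_1,\dots,\partial/\partial X_n)$ to $G$. For a nonzero homogeneous $F\in S$ put $\operatorname{Ann}_R(F)=\{p\in R : p\circ F=0\}$ and $A_F=R/\operatorname{Ann}_R(F)$. This is a standard graded Artinian Gorenstein $K$-algebra, and $F$ is called its Macaulay dual generator. A standard graded Artinian $K$-algebra $A$ (with degree-$i$ component $[A]_i$) has the weak Lefschetz property if there is a linear form $\ell\in[A]_1$ such that for all integers $i\ge 0$ the multiplication map $\times\ell:[A]_i\to[A]_{i+1}$ has maximal rank (i.e. is injective or surjective). It has the strong Lefschetz property if there is a linear form $\ell\in[A]_1$ such that for all integers $i\ge 0$ and $k\ge 1$ the multiplication map $\times\ell^k:[A]_i\to[A]_{i+k}$ has maximal rank. *)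

(* Defs.v *)
From HB Require Import structures.
From mathcomp Require Import all_boot all_order all_algebra.
From mathcomp Require Import ssrcomplements mpoly.

Set Implicit Arguments.
Unset Strict Implicit.
Unset Printing Implicit Defensive.

Import GRing.Theory.
Local Open Scope ring_scope.
Local Open Scope quotient_scope.

(* A graded ring is presented as a commutative ring A with its family of
   homogeneous components gr : nat -> A -> Prop. *)
Section Lefschetz.

Variables (A : comNzRingType) (gr : nat -> A -> Prop).

Definition mul_injective (i : nat) (u : A) : Prop :=
  forall x y : A, gr i x -> gr i y -> u * x = u * y -> x = y.

Definition mul_surjective (i j : nat) (u : A) : Prop :=
  forall y : A, gr j y -> exists2 x : A, gr i x & u * x = y.

Definition mul_maximal_rank (i j : nat) (u : A) : Prop :=
  mul_injective i u \/ mul_surjective i j u.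

Definition weak_Lefschetz : Prop :=
  exists2 l : A, gr 1 l & forall i : nat, mul_maximal_rank i i.+1 l.

Definition strong_Lefschetz : Prop :=
  exists2 l : A, gr 1 l &
    forall i k : nat, (0 < k)%N -> mul_maximal_rank i (i + k) (l ^+ k).

End Lefschetz.

Section MacaulayDual.

Variables (K : fieldType) (n : nat).
Implicit Types (p q G F : {mpoly K[n]}).

(* Both R and S are {mpoly K[n]}; p acts on G by substituting the partial
   derivative in the i-th variable for the i-th variable of p. *)
Definition apolar p G : {mpoly K[n]} := \sum_(m <- msupp p) p@_m *: G^`M[m].

Lemma apolarwE k p G : (msize p <= k)%N ->
  apolar p G = \sum_(m : 'X_{1..n < k}) p@_m *: G^`M[m].
Proof.
move=> le_pk; pose I : subFinType _ := 'X_{1..n < k}.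
rewrite /apolar (big_mksub I) /=; first last.
- by move=> m /msize_mdeg_lt /leq_trans; apply.
- exact: msupp_uniq.
rewrite big_rmcond //= => m /memN_msupp_eq0 ->.
by rewrite scale0r.
Qed.

Lemma apolarDl p q G : apolar (p + q) G = apolar p G + apolar q G.
Proof.
pose k := maxn (msize (p + q)) (maxn (msize p) (msize q)).
rewrite !(@apolarwE k) ?leq_max ?leqnn ?orbT // -big_split /=.
by apply: eq_bigr => m _; rewrite mcoeffD scalerDl.
Qed.

Lemma apolarZl (c : K) p G : apolar (c *: p) G = c *: apolar p G.
Proof.
pose k := maxn (msize (c *: p)) (msize p).
rewrite !(@apolarwE k) ?leq_max ?leqnn ?orbT // scaler_sumr.
by apply: eq_bigr => m _; rewrite mcoeffZ scalerA.
Qed.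

Lemma apolarX m G : apolar 'X_[m] G = G^`M[m].
Proof. by rewrite /apolar msuppX big_seq1 mcoeffX eqxx scale1r. Qed.

Lemma apolar0l G : apolar 0 G = 0.
Proof. by rewrite /apolar msupp0 big_nil. Qed.

Lemma apolar0r p : apolar p 0 = 0.
Proof. by rewrite /apolar big1 // => m _; rewrite linear0 scaler0. Qed.

Lemma apolar1l G : apolar 1 G = G.
Proof. by rewrite -mpolyX0 apolarX mderivm0m. Qed.

Lemma apolar_suml (I : Type) (r : seq I) (P : pred I) f G :
  apolar (\sum_(i <- r | P i) f i) G = \sum_(i <- r | P i) apolar (f i) G.
Proof.
exact: (big_morph (apolar^~ G) (fun p q => apolarDl p q G) (apolar0l G)).
Qed.

Lemma apolarXM m q G : apolar ('X_[m] * q) G = (apolar q G)^`M[m].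
Proof.
rewrite {1}[q]mpolyE mulr_sumr apolar_suml [apolar q G]/apolar linear_sum.
apply: eq_bigr => m' _ /=.
by rewrite -scalerAr -mpolyXD apolarZl apolarX linearZ addmC mderivmDm.
Qed.

Lemma apolarM p q G : apolar (p * q) G = apolar p (apolar q G).
Proof.
rewrite {1}[p]mpolyE mulr_suml apolar_suml; apply: eq_bigr => m _.
by rewrite -scalerAl apolarZl apolarXM.
Qed.

(* The proof of F != 0 makes Ann_R(F) a proper ideal, so that the quotient of
   R by it is a (nonzero) ring. *)
Definition Ann F (nzF : F != 0) : {pred {mpoly K[n]}} :=
  [pred p | apolar p F == 0].

Lemma Ann_idealr F (nzF : F != 0) : idealr_closed (Ann nzF).
Proof.
split=> [||a u v]; rewrite !inE ?apolar0l ?apolar1l // => /eqP u0 /eqP v0.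
by rewrite apolarDl apolarM u0 v0 apolar0r addr0.
Qed.

HB.instance Definition _ F (nzF : F != 0) :=
  isIdealr.Build {mpoly K[n]} (Ann nzF) (Ann_idealr nzF).

Definition gorenstein F (nzF : F != 0) : comNzRingType :=
  {ideal_quot (Ann nzF)}.

(* [A_F]_i is the image of the space of forms of degree i of R. *)
Definition gorenstein_comp F (nzF : F != 0) (i : nat) (x : gorenstein nzF) :
    Prop :=
  exists2 p : {mpoly K[n]}, p \is i.-homog & x = \pi_{ideal_quot (Ann nzF)} p.

Definition has_WLP F (nzF : F != 0) : Prop :=
  weak_Lefschetz (@gorenstein_comp F nzF).

Definition has_SLP F (nzF : F != 0) : Prop :=
  strong_Lefschetz (@gorenstein_comp F nzF).

End MacaulayDual.

(* The variables X_1, ..., X_n are 'X_i with i : 'I_n counted from 0, so X_k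
   is the variable whose index has value k - 1. *)
Definition ord_1st n (n_ge2 : (2 <= n)%N) : 'I_n := Ordinal (ltnW n_ge2).
Definition ord_2nd n (n_ge2 : (2 <= n)%N) : 'I_n := Ordinal n_ge2.

(* Main.v *)
Require Import Defs.
From mathcomp Require Import all_boot all_order all_algebra.
From mathcomp Require Import mpoly ring zify.

(** Apart from (1), every binomial of the statement has, up to sign, the form
    k1 X^e1 + k2 X^e2 with e1 j <= e2 j for all j except one index x; all of
    these have the strong Lefschetz property.  Put p = e1 x - e2 x > 0 and
    N = X^(e2 - e1), a monomial of degree p free of X_x.  Giving X_x the weight
    t and letting t tend to 0, A_F degenerates to a monomial algebra whose
    X_x-strata split it into three boxes
      X_x-degree in [0, e2 x]:                 divisors of X^e2,
      X_x-degree in [e2 x + 1, (k + 1)p - 1]:  divisors of X^e1 / N^k,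
      X_x-degree in [(k + 1)p, e1 x]:          divisors of X^e1 / N^(k + 1),
    where k = (e2 x + 1) / p rounded down.  Each box is centred at half of the
    socle degree, so by the representation theory of sl_2 the sum of the
    variables is a strong Lefschetz element on it; hence it is one for the
    degeneration and, a determinant polynomial in t being nonzero at t = 0, the
    form t x_x + sum_(j <> x) x_j is one for A_F and almost every t.  Only
    injectivity up to the middle degree is needed, by Gorenstein duality.

    In (1) the form x_1 itself works: if i < a_1 and p has degree i, every
    monomial of p o F is divisible by X_1, so that its derivative along X_1 can
    vanish only if p o F = 0, and the hypothesis says that a_1 exceeds half of
    the socle degree. *)

Set Implicit Arguments.
Unset Strict Implicit.
Unset Printing Implicit Defensive.

Import GRing.Theory.
Local Open Scope ring_scope.

(** * The sl_2 action on functions on a box of exponents *)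

Section Box.

Variables (K : fieldType) (n : nat).
Hypothesis charK0 : [pchar K] =i pred0.
Implicit Types (h : 'X_{1..n} -> K) (v w e : 'X_{1..n}).

Lemma natr_neq0 k : ((k.+1)%:R : K) != 0.
Proof. by rewrite (pcharf0P K).1. Qed.

(** Differentiation by the sum of all variables, read on divided power coefficients. *)
Definition lower h v : K := \sum_(i < n) h (v + U_(i))%MM.

(** The raising operator on the tensor product of the irreducible sl_2-modules of dimensions
    [e j + 1]. The factor [v j] neutralises the truncated subtraction at [v j = 0]; the other one
    keeps the support inside the box. *)
Definition raise e h v : K :=
  \sum_(j < n) (v j)%:R * ((e j)%:R + 1 - (v j)%:R) * h (v - U_(j))%MM.

Lemma eq_lower h h' : h =1 h' -> lower h =1 lower h'.
Proof. by move=> eqh v; apply: eq_bigr => i _; rewrite eqh. Qed.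

Lemma eq_iter_lower s h h' : h =1 h' -> iter s lower h =1 iter s lower h'.
Proof. by move=> eqh; elim: s => //= s IHs; apply: eq_lower. Qed.

Lemma lower0 h : h =1 (fun=> 0) -> lower h =1 (fun=> 0).
Proof. by move=> h0 v; rewrite /lower big1. Qed.

Lemma raise0 e h : h =1 (fun=> 0) -> raise e h =1 (fun=> 0).
Proof. by move=> h0 v; rewrite /raise big1 // => j _; rewrite h0 mulr0. Qed.

Lemma lowerD h h' v : lower (fun w => h w + h' w) v = lower h v + lower h' v.
Proof. exact: big_split. Qed.

Lemma lowerZ a h v : lower (fun w => a * h w) v = a * lower h v.
Proof. by rewrite /lower mulr_sumr. Qed.

(** The sl_2 commutator: terms with distinct indices commute, and a diagonal one leaves
    [(v + 1)(e - v) - v(e + 1 - v) = e - 2v]. *)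
Lemma lower_raise e h v :
  lower (raise e h) v
  = raise e (lower h) v + ((mdeg e)%:R - (mdeg v)%:R *+ 2) * h v.
Proof.
pose T i j := (v j)%:R * ((e j)%:R + 1 - (v j)%:R) * h (v - U_(j) + U_(i))%MM.
have Eij i j : ((v + U_(i))%MM j)%:R * ((e j)%:R + 1 - ((v + U_(i))%MM j)%:R)
     * h (v + U_(i) - U_(j))%MM
   = T i j + (if j == i then ((e j)%:R - (v j)%:R *+ 2) * h v else 0).
  rewrite /T mnmDE mnm1E (eq_sym j); have [<-|neij] := eqVneq i j; last first.
    rewrite addn0 addr0; have [->|vj_gt0] := posnP (v j); first by rewrite !mul0r.
    congr (_ * h _); apply/mnmP=> l; rewrite !(mnmDE, mnmBE) !mnm1E.
    by have [?|_] := eqVneq i l; have [?|_] := eqVneq j l; subst => //=; lia.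
  rewrite addmK; have [v0|v_gt0] := posnP (v i).
    by rewrite v0 add0n /=; ring.
  rewrite submK; last by rewrite lep1mP -lt0n.
  by rewrite natrD /=; ring.
rewrite /lower /raise.
under eq_bigr => i _ do under eq_bigr => j _ do rewrite Eij.
under eq_bigr => i _ do rewrite big_split /= -big_mkcond big_pred1_eq.
rewrite big_split /=; congr (_ + _).
  rewrite exchange_big /=; apply: eq_bigr => j _.
  by rewrite /T -mulr_sumr.
rewrite -mulr_suml sumrB -!natr_sum !mdegE; congr ((_ - _) * _).
by rewrite natr_sum -sumrMnl.
Qed.

Definition supp_deg r h := forall v, h v != 0 -> mdeg v = r.

Lemma iter_lower_deg r h s v :
  supp_deg r h -> iter s lower h v != 0 -> (mdeg v + s)%N = r.
Proof.
move=> degh; elim: s v => [|s IHs] v /=; first by rewrite addn0; apply: degh.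
move=> nz; have /existsP[i nzi] : [exists i : 'I_n,
    iter s lower h (v + U_(i))%MM != 0].
  apply: contraNT nz; rewrite negb_exists => /forallP z.
  by rewrite /lower big1 // => i _; apply/eqP; rewrite -[_ == _]negbK z.
by rewrite -(IHs _ nzi) mdegD mdeg1 addn1 addSnnS.
Qed.

(** Adds up the weights [mdeg e - 2(r - t)], [t = 0, ..., s], met while [raise] moves past [s + 1]
    copies of [lower]. *)
Lemma iter_lower_raise e r h s v : supp_deg r h ->
  iter s.+1 lower (raise e h) v
  = raise e (iter s.+1 lower h) v
    + s.+1%:R * ((mdeg e)%:R - r%:R *+ 2 + s%:R) * iter s lower h v.
Proof.
move=> degh; elim: s v => [|s IHs] v.
  rewrite /= lower_raise; congr (_ + _).
  have [->|nz] := eqVneq (h v) 0; first by rewrite !mulr0.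
  by rewrite (degh _ nz) addr0 mul1r.
rewrite iterS (eq_lower IHs) lowerD lowerZ lower_raise -addrA; congr (_ + _).
have [z|nz] := eqVneq (iter s.+1 lower h v) 0.
  by rewrite /= in z *; rewrite z !mulr0 add0r.
rewrite -(iter_lower_deg degh nz) -iterS -mulrDl; congr (_ * _).
by rewrite natrD; ring.
Qed.

(* Representation theory of sl_2: [raise] and [lower] generate an action on the
   functions supported in the box [w <= e], with weight [mdeg e - 2 mdeg w]. *)
Lemma box_lower_inj e r h s :
  supp_deg r h -> (forall w, h w != 0 -> (w <= e)%MM) ->
  (s + mdeg e <= 2 * r)%N -> iter s lower h =1 (fun=> 0) -> h =1 (fun=> 0).
Proof.
(* Downward induction on [r], starting above the top degree of the box, then induction on [s]. *)
have [k le_k] := ubnP ((mdeg e).+1 - r); elim: k r h s le_k => // k IHk r h s le_k.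
move=> degh boxh les Dh0.
have [lt_er|le_re] := ltnP (mdeg e) r.
  move=> w; apply/eqP; apply: contraTT lt_er => nzw.
  rewrite -leqNgt -(degh _ nzw) -(submK (boxh _ nzw)) mdegD.
  by rewrite leq_addl.
elim: s les Dh0 => [|s IHs] les Dh0; first exact: Dh0.
apply: IHs; first by lia.
have degU : supp_deg r.+1 (raise e h).
  move=> v nz; have /existsP[j] : [exists j : 'I_n,
     ((v j)%:R * ((e j)%:R + 1 - (v j)%:R) * h (v - U_(j))%MM) != 0].
    apply: contraNT nz; rewrite negb_exists => /forallP z.
    by rewrite /raise big1 // => j _; apply/eqP; rewrite -[_ == _]negbK z.
  rewrite !mulf_eq0 !negb_or => /andP[/andP[vj _] nzh].
  have vj0 : v j != 0%N by apply: contraNneq vj => ->.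
  by rewrite -(degh _ nzh) -addn1 -(mdeg1 j) -mdegD submK // lep1mP.
have boxU v : raise e h v != 0 -> (v <= e)%MM.
  move=> nz; have /existsP[j] : [exists j : 'I_n,
     ((v j)%:R * ((e j)%:R + 1 - (v j)%:R) * h (v - U_(j))%MM) != 0].
    apply: contraNT nz; rewrite negb_exists => /forallP z.
    by rewrite /raise big1 // => j _; apply/eqP; rewrite -[_ == _]negbK z.
  rewrite !mulf_eq0 !negb_or => /andP[/andP[vj evj] /boxh /mnm_lepP le_vu].
  apply/mnm_lepP => l; move: (le_vu l); rewrite mnmBE mnm1E.
  have [<-|_] := eqVneq j l; last by rewrite subn0.
  rewrite leq_subLR add1n leq_eqVlt ltnS => /predU1P[vE|//].
  by rewrite vE -natr1 subrr eqxx in evj.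
(* In degree [r + 1], both terms of the commutation formula vanish along with
   [iter s.+1 lower h]. *)
have U0 : raise e h =1 (fun=> 0).
  apply: (IHk r.+1 _ s.+2) => // [||v]; [lia|lia|].
  rewrite (iter_lower_raise _ _ _ degh) Dh0 mulr0 addr0.
  by rewrite raise0 //; apply: lower0.
(* Since [raise e h = 0], only a multiple of [iter s lower h] is left, with a nonzero factor because
   [2r > s + mdeg e]. *)
move=> v; move: (iter_lower_raise e s v degh).
rewrite (eq_iter_lower _ U0) [X in X + _](raise0 _ Dh0) add0r.
have -> : iter s.+1 lower (fun=> 0 : K) v = 0.
  by move: v; elim: (s.+1) => //= k' IH v; rewrite lower0.
move/esym/eqP; rewrite !mulf_eq0 (negPf (natr_neq0 _)) /= => /orP[|/eqP//].
have -> : (mdeg e)%:R - r%:R *+ 2 + s%:R = - (2 * r - (s + mdeg e))%:R :> K.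
  rewrite natrB ?natrD ?natrM; last lia.
  ring.
rewrite oppr_eq0; have -> : (2 * r - (s + mdeg e) = (2 * r - (s.+1 + mdeg e)).+1)%N by lia.
by rewrite (negPf (natr_neq0 _)).
Qed.

End Box.

(** * Degeneration of a binomial to three boxes *)

Section Perturbation.

Variable K : fieldType.

(** With [C] a right inverse of [A], the polynomial [det ((A + tau B) C)] in [tau] is 1 at 0, and
    wherever it is nonzero [A + tau B] has a right inverse. *)
Lemma row_free_perturb (m k : nat) (A B : 'M[K]_(m, k)) : row_free A ->
  exists2 D : {poly K}, D.[0] != 0 &
    forall tau, D.[tau] != 0 -> row_free (A + tau *: B).
Proof.
case/row_freeP => C AC1.
pose D := \det (1%:M + 'X *: map_mx polyC (B *m C)).
have DE tau : D.[tau] = \det ((A + tau *: B) *m C).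
  rewrite -horner_evalE /D -det_map_mx; congr (\det _).
  rewrite mulmxDl AC1 -scalemxAl; apply/matrixP => i j.
  rewrite !mxE /= horner_evalE hornerD hornerM hornerX hornerC.
  by rewrite -polyC_natr hornerC.
exists D => [|tau].
  by rewrite DE scale0r addr0 AC1 det1 oner_neq0.
rewrite DE -unitfE => unitAC; apply/row_freeP.
by exists (C *m invmx ((A + tau *: B) *m C)); rewrite mulmxA mulmxV.
Qed.

Lemma fin_kernel_perturb (I J : finType) (A B : I -> J -> K) :
  (forall x : I -> K, (forall j, \sum_i x i * A i j = 0) -> x =1 (fun=> 0)) ->
  exists2 D : {poly K}, D.[0] != 0 &
    forall tau, D.[tau] != 0 -> forall x : I -> K,
      (forall j, \sum_i x i * (A i j + tau * B i j) = 0) -> x =1 (fun=> 0).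
Proof.
move=> injA.
pose mx (M : I -> J -> K) := \matrix_(i < #|I|, j < #|J|)
  M (enum_val i) (enum_val j).
have mxE' M (x : I -> K) j : (\row_i x (enum_val i) *m mx M) 0 j
    = \sum_i x i * M i (enum_val j).
  rewrite mxE (reindex (@enum_val I I)) /=; last exact/onW_bij/enum_val_bij.
  by apply: eq_bigr => i _; rewrite !mxE.
have [|D D0 Dfree] := @row_free_perturb _ _ (mx A) (mx B).
  apply/inj_row_free => v vA0; apply/rowP => i.
  pose x k := v 0 (enum_rank k).
  have vE : v = \row_i x (enum_val i) by apply/rowP => k; rewrite mxE /x enum_valK.
  rewrite vE !mxE; apply: (injA x) => j.
  by have := mxE' A x (enum_rank j); rewrite enum_rankK => <-; rewrite -vE vA0 mxE.
exists D => // tau /Dfree freeAB x x0 i.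
have : \row_i x (enum_val i) *m (mx A + tau *: mx B) = 0.
  apply/rowP => j; rewrite [RHS]mxE -[RHS](x0 (enum_val j)).
  rewrite -(mxE' (fun i j => A i j + tau * B i j)).
  by congr ((_ *m _) 0 j); apply/matrixP => ? ?; rewrite !mxE.
move/eqP; rewrite mulmx_free_eq0 // => /eqP/rowP/(_ (enum_rank i)).
by rewrite !mxE enum_rankK.
Qed.

End Perturbation.

(** * Standard exponents and the inversion of [1 - tau shift] *)

Section Binomial.

Variables (K : fieldType) (n : nat).
Hypothesis charK0 : [pchar K] =i pred0.
Variables (x : 'I_n) (e1 e2 : 'X_{1..n}).
Hypothesis le_e12 : forall j, j != x -> (e1 j <= e2 j)%N.
Hypothesis deg_e12 : mdeg e1 = mdeg e2.
Hypothesis neq_e12 : e1 != e2.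
Implicit Types (c f g h : 'X_{1..n} -> K) (v w : 'X_{1..n}).

Let p := (e1 x - e2 x)%N.
Let N := (e2 - e1)%MM.

(** Otherwise [e1 <= e2] everywhere, and equality of degrees would force [e1 = e2]. *)
Lemma binomial_x_lt : (e2 x < e1 x)%N.
Proof.
rewrite ltnNge; apply: contraNN neq_e12 => le_x.
have le12 : (e1 <= e2)%MM.
  by apply/mnm_lepP => j; have [->|/le_e12] := eqVneq j x.
apply/eqP; rewrite -[RHS](submK le12); have : mdeg (e2 - e1) = 0%N.
  by move: deg_e12; rewrite -[in mdeg e2](submK le12) mdegD; lia.
by move/eqP; rewrite mdeg_eq0 => /eqP ->; rewrite add0m.
Qed.

Let p_gt0 : (0 < p)%N. Proof. by rewrite subn_gt0 binomial_x_lt. Qed.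

Lemma subm_e12 : (e1 - e2 = U_(x) *+ p)%MM.
Proof.
apply/mnmP => j; rewrite mnmBE mulmnE mnm1E.
have [<-|] := eqVneq x j; first by rewrite mul1n.
by rewrite eq_sym mul0n => /le_e12; rewrite -subn_eq0 => /eqP.
Qed.

Lemma N_x : N x = 0%N.
Proof. by rewrite mnmBE; apply/eqP; rewrite subn_eq0 ltnW // binomial_x_lt. Qed.

Lemma mdeg_N : mdeg N = p.
Proof.
have : (e2 + (e1 - e2) = e1 + N)%MM.
  by apply/mnmP => j; rewrite !mnmDE !mnmBE; lia.
move/(congr1 mdeg); rewrite !mdegD deg_e12 subm_e12 mdegMn mdeg1 mul1n.
by move/addnI.
Qed.

(* The exponents standing for a basis of the inverse system of the initial
   ideal: three boxes (cut by the values of [w x %/ p]), each of them centred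
   at half the degree of the binomial. *)
Definition standard w : bool :=
  (w <= e2)%MM ||
  (e2 x < w x <= e1 x)%N &&
    [forall j, (j != x) ==> (w j + (w x %/ p) * N j <= e1 j)%N].

(** Translation by [lo] commutes with [lower]. It decreases [r] by [mdeg lo], while passing from [e]
    to [e - z] decreases the degree by twice as much, so the inequality of [box_lower_inj]
    persists. *)
Lemma shifted_box_lower_inj c (r s : nat) (lo z e : 'X_{1..n}) :
  supp_deg r c -> mdeg z = (2 * mdeg lo)%N -> (s + mdeg e <= 2 * r)%N ->
  (forall v, c (lo + v)%MM != 0 -> (v + z <= e)%MM) ->
  iter s (@lower K n) c =1 (fun=> 0) -> forall v, c (lo + v)%MM = 0.
Proof.
move=> degc degz les boxc Dc0 v; apply/eqP/negPn/negP => nzv.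
have le_ze : (z <= e)%MM by apply: lepm_trans (boxc _ nzv); apply: lem_addl.
pose h v := c (lo + v)%MM; case/negP: (nzv); apply/eqP.
have mde : (mdeg (e - z) + mdeg z = mdeg e)%N by rewrite -mdegD submK.
apply: (@box_lower_inj K n charK0 (e - z)%MM (r - mdeg lo) h s _ _ _ _ v).
- by move=> u /degc; rewrite mdegD => <-; rewrite addKn.
- move=> u /boxc /mnm_lepP le_uz; apply/mnm_lepP => j.
  by move: (le_uz j); rewrite mnmDE mnmBE; lia.
- by lia.
move=> u; rewrite -[RHS](Dc0 (lo + u)%MM).
elim: s {les Dc0} u => //= s IHs u; apply: eq_bigr => i _.
by rewrite IHs addmA.
Qed.

(** As [lower] reads only larger exponents, the strata can be cleared from the largest [X_x]-degree
    downwards; what remains above each threshold lies in a single box. *)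
Lemma standard_lower_inj c (r s : nat) :
  supp_deg r c -> (forall w, c w != 0 -> standard w) ->
  (s + mdeg e1 <= 2 * r)%N -> iter s (@lower K n) c =1 (fun=> 0) ->
  c =1 (fun=> 0).
Proof.
move=> degc stdc les Dc0.
have /= px := binomial_x_lt.
pose k := ((e2 x).+1 %/ p)%N.
have k_le : (k * p <= (e2 x).+1)%N := leq_divM _ _.
have k_gt : ((e2 x).+1 < k.+1 * p)%N by rewrite ltn_ceil.
have stdP w : (e2 x < w x)%N -> c w != 0 ->
   (w x <= e1 x)%N /\ forall j, j != x -> (w j + (w x %/ p) * N j <= e1 j)%N.
  move=> ltw /stdc/orP[/mnm_lepP/(_ x)|/andP[/andP[_ ->] /forallP H]].
    by rewrite leqNgt ltw.
  by split=> // j; apply/implyP.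
have step (m : nat) :
    (forall v, c (U_(x) *+ m + v)%MM = 0) -> forall w, (m <= w x)%N -> c w = 0.
  move=> H w lew; have le_mw : (U_(x) *+ m <= w)%MM.
    apply/mnm_lepP => j; rewrite mulmnE mnm1E; case: eqVneq => [<-|//].
    by rewrite mul1n.
  by rewrite -(submK le_mw) addmC H.
have c0top w : (k.+1 * p <= w x)%N -> c w = 0.
  apply: step => //.
  (* As [N] has degree [p], this [z] has degree [2(k + 1)p], twice that of the lower corner. *)
  apply: (@shifted_box_lower_inj c r s _ ((U_(x) *+ p + N) *+ k.+1)%MM e1) => //.
    by rewrite !mdegMn mdegD mdeg_N mdegMn mdeg1; lia.
  move=> v nz; have [|le_x le_j] := stdP _ _ nz.
    by rewrite mnmDE mulmnE mnm1E eqxx; lia.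
  have wx : (U_(x) *+ (k.+1 * p) + v)%MM x = (k.+1 * p + v x)%N.
    by rewrite mnmDE mulmnE mnm1E eqxx mul1n.
  apply/mnm_lepP => j; rewrite !(mnmDE, mulmnE) mnm1E.
  have [<-|nejx] := eqVneq x j; first by rewrite N_x; lia.
  rewrite eq_sym in nejx; apply: leq_trans (le_j _ nejx).
  rewrite wx mnmDE mulmnE mnm1E eq_sym (negPf nejx) mul0n add0n.
  rewrite leq_add2l mulnC leq_mul2r; apply/orP; right.
  by rewrite leq_divRL // leq_addr.
have c0mid w : (e2 x < w x)%N -> c w = 0.
  apply: step => //.
  (* The multiplicity [2(e2 x + 1) - kp] gives [z] the degree [2(e2 x + 1)] and stops the box at
     [w x = (k + 1)p - 1], just below the range of [c0top]. *)
  apply: (@shifted_box_lower_inj c r s _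
      (U_(x) *+ (2 * (e2 x).+1 - k * p) + N *+ k)%MM e1) => //.
    by rewrite !(mdegMn, mdegD) mdeg_N mdeg1; lia.
  move=> v nz; have [|le_x le_j] := stdP _ _ nz.
    by rewrite mnmDE mulmnE mnm1E eqxx; lia.
  have wx : (U_(x) *+ (e2 x).+1 + v)%MM x = ((e2 x).+1 + v x)%N.
    by rewrite mnmDE mulmnE mnm1E eqxx mul1n.
  have wlt : ((e2 x).+1 + v x < k.+1 * p)%N.
    by rewrite ltnNge; apply: contraNN nz => le; rewrite c0top ?wx.
  apply/mnm_lepP => j; rewrite !(mnmDE, mulmnE) mnm1E.
  have [<-|nejx] := eqVneq x j.
    by rewrite N_x; move: wlt; rewrite mulSn /p; lia.
  rewrite eq_sym in nejx; apply: leq_trans (le_j _ nejx).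
  rewrite wx mnmDE mulmnE mnm1E eq_sym (negPf nejx) mul0n add0n.
  rewrite leq_add2l mulnC leq_mul2r; apply/orP; right.
  by rewrite /k leq_div2r // leq_addr.
move=> w; rewrite -[w]add0m.
apply: (@shifted_box_lower_inj c r s _ 0%MM e2) => //.
- by rewrite !mdeg0.
- by rewrite -deg_e12.
move=> v; rewrite add0m addm0 => nz.
case/orP: (stdc _ nz) => // /andP[/andP[/c0mid c0 _] _].
by rewrite c0 eqxx in nz.
Qed.

(* In the divided power basis [X^[w]], up to scalars, the monomial of exponent
   [e2 - w] maps [X^e2 - tau X^e1] to [X^[w] - tau X^[w + e1 - e2]], and
   [c - tau * shift c] is the combination of these with coefficients [c]. *)
Definition shift c w : K :=
  if (p <= w x <= e1 x)%N then c (w - (e1 - e2) + N)%MM else 0.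

Lemma mdeg_shift w : (p <= w x)%N -> mdeg (w - (e1 - e2) + N)%MM = mdeg w.
Proof.
move=> lew; have le_pw : (e1 - e2 <= w)%MM.
  rewrite subm_e12; apply/mnm_lepP => j; rewrite mulmnE mnm1E.
  by case: eqVneq => [<-|]; rewrite ?mul1n.
rewrite mdegD mdeg_N -[in RHS](submK le_pw) mdegD subm_e12.
by rewrite mdegMn mdeg1 mul1n.
Qed.

Lemma shift_deg r c : supp_deg r c -> supp_deg r (shift c).
Proof.
move=> degc w; rewrite /shift; case: ifP => [/andP[lew _] /degc|]; last first.
  by rewrite eqxx.
by rewrite mdeg_shift.
Qed.

Lemma iter_lower_sum (I : finType) (y : I -> K) (g : I -> 'X_{1..n} -> K) s v :
  iter s (@lower K n) (fun w => \sum_i y i * g i w) v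
  = \sum_i y i * iter s (@lower K n) (g i) v.
Proof.
elim: s v => //= s IHs v; rewrite (eq_lower IHs) /lower exchange_big /=.
by apply: eq_bigr => i _; rewrite mulr_sumr.
Qed.

Lemma iter_lower_subZ f g a s v :
  iter s (@lower K n) (fun w => f w - a * g w) v
  = iter s (@lower K n) f v - a * iter s (@lower K n) g v.
Proof.
elim: s v => //= s IHs v; rewrite (eq_lower IHs) /lower sumrB.
by rewrite mulr_sumr.
Qed.

Definition delta w0 w : K := (w0 == w)%:R.

Lemma supp_deg_sum r c : supp_deg r c -> forall w,
  c w = \sum_(u : 'X_{1..n < r.+1}) c u * delta u w.
Proof.
move=> degc w; have [ltw|gew] := ltnP (mdeg w) r.+1.
  rewrite (bigD1 (BMultinom ltw)) //= /delta eqxx mulr1 big1 ?addr0 // => u neu.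
  rewrite (_ : (u == w :> 'X_{1..n}) = false) ?mulr0 //.
  by apply: contraNF neu => /eqP uw; apply/eqP/val_inj.
have [->|/degc degw] := eqVneq (c w) 0; last by rewrite degw ltnn in gew.
rewrite big1 // => u _; rewrite /delta; case: eqVneq => [uw|]; last by rewrite mulr0.
by have := bmdeg u; rewrite uw ltnNge gew.
Qed.

(** At [tau = 0] this is [standard_lower_inj]; the equations form a finite linear system, affine in
    [tau], to which the perturbation lemma applies. *)
Lemma generic_standard_inj (r s : nat) : (s + mdeg e1 <= 2 * r)%N ->
  exists2 D : {poly K}, D.[0] != 0 &
    forall tau, D.[tau] != 0 -> forall c,
      supp_deg r c -> (forall w, c w != 0 -> standard w) ->
      iter s (@lower K n) (fun w => c w - tau * shift c w) =1 (fun=> 0) ->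
      c =1 (fun=> 0).
Proof.
move=> les; pose I := 'X_{1..n < r.+1}.
(* The second summand of [J] holds the equations forcing the unknown function
   to be supported on the standard exponents of degree [r]. *)
pose J := (I + I)%type.
pose good (u : I) := (mdeg u == r) && standard u.
pose A (u : I) (j : J) : K := match j with
  | inl v => iter s (@lower K n) (delta u) v
  | inr v => ((u == v) && ~~ good u)%:R end.
pose B (u : I) (j : J) : K := match j with
  | inl v => - iter s (@lower K n) (shift (delta u)) v
  | inr v => 0 end.
have [|D D0 Dinj] := @fin_kernel_perturb K I J A B.
  move=> y y0; pose c w := \sum_(u : I) y u * delta u w.
  have cE (u : I) : c u = y u.
    rewrite /c (bigD1 u) //= /delta eqxx mulr1 big1 ?addr0 // => u' neu.
    rewrite (_ : (u' == u :> 'X_{1..n}) = false) ?mulr0 //.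
    by apply: contraNF neu => /eqP uw; apply/eqP/val_inj.
  have ybad u : ~~ good u -> y u = 0.
    move=> badu; move: (y0 (inr u)); rewrite /A (bigD1 u) //= eqxx badu mulr1.
    by rewrite big1 ?addr0 // => u' /negPf ->; rewrite mulr0.
  have goodc w : c w != 0 -> mdeg w = r /\ standard w.
    move=> nzw; have [u] : exists u : I, u == w :> 'X_{1..n}.
      apply/existsP; apply: contraNT nzw; rewrite negb_exists => /forallP z.
      by apply/eqP; apply: big1 => u _; rewrite /delta (negPf (z u)) mulr0.
    move/eqP=> uw; rewrite -uw cE in nzw *.
    have /andP[/eqP //] : good u by apply: contraNT nzw => /ybad ->.
  move=> u; rewrite -cE.
  apply: (@standard_lower_inj c r s) => //.
  - by move=> w /goodc[].
  - by move=> w /goodc[].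
  move=> v; have [ltv|gev] := ltnP (mdeg v) r.+1.
    by rewrite iter_lower_sum -[RHS](y0 (inl (BMultinom ltv))).
  apply/eqP/negPn/negP => nz.
  have : (mdeg v + s)%N = r by apply: iter_lower_deg nz => w /goodc[].
  lia.
exists D => // tau /Dinj {}Dinj c degc stdc Dc0 w.
rewrite (supp_deg_sum degc) big1 // => u _.
rewrite (Dinj (fun u : I => c u)) ?mul0r // => -[v|v] /=; last first.
  rewrite big1 // => u' _; rewrite mulr0 addr0.
  case: eqP => [->|]; rewrite ?mulr0 //=; case: (boolP (good v)) => badv; rewrite ?mulr0 // mulr1.
  apply/eqP; apply: contraNT badv => nz; rewrite /good stdc // andbT.
  by rewrite (degc _ nz).
rewrite -[RHS](Dc0 v).
pose g (u : I) w := delta u w - tau * shift (delta u) w.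
have gE w' : c w' - tau * shift c w' = \sum_(u : I) c u * g u w'.
  under [RHS]eq_bigr => u' _ do rewrite /g mulrBr.
  rewrite sumrB -(supp_deg_sum degc); congr (_ - _).
  rewrite /shift; case: ifP => _; last first.
    by rewrite mulr0 big1 // => u' _; rewrite !mulr0.
  rewrite (supp_deg_sum degc) mulr_sumr; apply: eq_bigr => u' _; ring.
rewrite (eq_iter_lower _ gE) iter_lower_sum; apply: eq_bigr => u' _.
by congr (_ * _); rewrite iter_lower_subZ mulrN.
Qed.

(** The solution is the geometric series [sum_k tau^k shift^k f]. Each shift multiplies by [X_x^p]
    and divides by [N], so the [k]-th term lives where [w x %/ p = k] and has standard support. *)
Lemma shift_resolution r tau f :
  supp_deg r f -> (forall w, f w != 0 -> (w x < p)%N && (w <= e1)%MM) ->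
  exists c, [/\ supp_deg r c, forall w, c w != 0 -> standard w
    & forall w, c w - tau * shift c w = f w].
Proof.
move=> degf suppf; pose F k := iter k shift f.
have degF k : supp_deg r (F k) by elim: k => //= k IHk; apply: shift_deg.
have suppF k w : F k w != 0 -> [/\ (k * p <= w x < k.+1 * p)%N, (w x <= e1 x)%N
    & forall j, j != x -> (w j + k * N j <= e1 j)%N].
  elim: k w => [|k IHk] w.
    case/suppf/andP => ltw /mnm_lepP lew; split=> //.
    by rewrite mul0n mul1n ltw.
    by move=> j _; rewrite addn0.
  rewrite /F iterS /shift; case: ifP => [/andP[lepw lew]|]; last by rewrite eqxx.
  case/IHk; rewrite mnmDE mnmBE N_x addn0 subm_e12 mulmnE mnm1E eqxx mul1n.
  move=> /andP[h1 h2] h3 h4; split=> //.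
    by rewrite !mulSn in h2 *; lia.
  move=> j nej; move: (h4 j nej); rewrite !(mnmDE, mnmBE, mulmnE) mnm1E.
  by rewrite eq_sym (negPf nej) mul0n subn0 mulSn addnA.
(* Enough terms: the support of [F B] would need [w x >= (e1 x + 1)p > e1 x]. *)
pose B := (e1 x).+1.
pose c w := \sum_(k < B) tau ^+ k * F k w.
have cP w : c w != 0 -> exists k, F k w != 0.
  move=> nz; have /existsP[k nzk] : [exists k : 'I_B, F k w != 0].
    apply: contraNT nz; rewrite negb_exists => /forallP z.
    by rewrite /c big1 // => i _; rewrite (eqP (negbNE (z i))) mulr0.
  by exists k.
exists c; split.
- by move=> w /cP[k]; apply: degF.
- move=> w /cP[k /suppF[/andP[h1 h2] h3 h4]]; rewrite /standard.
  have [lew|ltw] := leqP (w x) (e2 x); last first.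
    apply/orP; right; rewrite h3; apply/forallP => j; apply/implyP => /h4.
    suff -> : (w x %/ p = k)%N by [].
    by apply/eqP; rewrite eqn_leq leq_divRL // h1 andbT -ltnS ltn_divLR.
  apply/orP; left; apply/mnm_lepP => j; have [->//|nej] := eqVneq j x.
  by apply: leq_trans (le_e12 nej); apply: leq_trans (h4 j nej); apply: leq_addr.
move=> w; have -> : shift c w = \sum_(k < B) tau ^+ k * F k.+1 w.
  rewrite /F; under [RHS]eq_bigr => k _ do rewrite iterS {1}/shift.
  rewrite /shift; case: ifP => // _; by rewrite big1 // => k _; rewrite mulr0.
rewrite mulr_sumr -sumrB.
rewrite (eq_bigr (fun k : 'I_B => (- (tau ^+ k.+1 * F k.+1 w)) - (- (tau ^+ k * F k w)))); last first.
  by move=> k _; rewrite mulrA -exprS opprK addrC.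
rewrite -(big_mkord xpredT (fun k => (- (tau ^+ k.+1 * F k.+1 w)) - (- (tau ^+ k * F k w)))).
rewrite telescope_sumr // expr0 mul1r opprK.
have [->|/suppF[]] := eqVneq (F B w) 0; first by rewrite mulr0 oppr0 add0r.
case/andP=> h1 _ h3 _; have : (B <= e1 x)%N.
  by apply: leq_trans h3; apply: leq_trans h1; rewrite leq_pmulr.
by rewrite ltnn.
Qed.

End Binomial.

(** * Apolarity and Gorenstein duality *)

(** The columns of the cokernel matrix lie in the kernel of [A], so [b] kills them, which is the
    criterion for membership in the row space. *)
Lemma fin_row_span (K : fieldType) (I J : finType) (A : I -> J -> K)
    (b : J -> K) :
  (forall y, (forall i, \sum_j A i j * y j = 0) -> \sum_j b j * y j = 0) ->
  exists z, forall j, b j = \sum_i z i * A i j.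
Proof.
move=> kerAb.
pose mA := \matrix_(i < #|I|, j < #|J|) A (enum_val i) (enum_val j).
pose rb := \row_(j < #|J|) b (enum_val j).
have [|D rbE] := @submxP K 1 _ _ rb mA _.
  rewrite submxE; apply/eqP/rowP => k; rewrite [LHS]mxE [RHS]mxE.
  pose y j := cokermx mA (enum_rank j) k.
  have sumE (f : J -> K) :
      \sum_(j < #|J|) f (enum_val j) * cokermx mA j k = \sum_j f j * y j.
    rewrite [RHS](reindex (@enum_val J J)) /=; last exact/onW_bij/enum_val_bij.
    by apply: eq_bigr => j _; rewrite /y enum_valK.
  under eq_bigr => j _ do rewrite mxE.
  rewrite sumE; apply: kerAb => i; rewrite -sumE.
  have : (mA *m cokermx mA) (enum_rank i) k = 0 by rewrite mulmx_coker mxE.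
  rewrite mxE => coker0; rewrite -[RHS]coker0; apply: eq_bigr => j _.
  by rewrite !mxE enum_rankK.
exists (fun i => D 0 (enum_rank i)) => j.
have /rowP/(_ (enum_rank j)) := rbE; rewrite !mxE enum_rankK => ->.
rewrite [RHS](reindex (@enum_val I I)) /=; last exact/onW_bij/enum_val_bij.
by apply: eq_bigr => i _; rewrite mxE enum_valK enum_rankK.
Qed.

Section Apolarity.

Variables (K : fieldType) (n : nat).
Hypothesis charK0 : [pchar K] =i pred0.
Implicit Types (p q u F G : {mpoly K[n]}) (v w : 'X_{1..n}).

Definition mfact w : nat := (\prod_(i < n) (w i)`!)%N.

Lemma mfact_neq0 w : ((mfact w)%:R : K) != 0.
Proof.
rewrite (pcharf0P K).1 // -lt0n prodn_gt0 // => i; exact: fact_gt0.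
Qed.

(* In the divided power basis differentiation becomes a mere shift. *)
Definition dcoef G w : K := (mfact w)%:R * G@_w.

Lemma dcoef_eq0 G w : (dcoef G w == 0) = (G@_w == 0).
Proof. by rewrite mulf_eq0 (negPf (mfact_neq0 w)). Qed.

Lemma dcoefP G H : (forall w, dcoef G w = dcoef H w) -> G = H.
Proof.
move=> eqGH; apply/mpolyP => w; apply: (mulfI (mfact_neq0 w)); exact: eqGH.
Qed.

Lemma dcoef0 w : dcoef 0 w = 0.
Proof. by rewrite /dcoef mcoeff0 mulr0. Qed.

Lemma dcoefD G H w : dcoef (G + H) w = dcoef G w + dcoef H w.
Proof. by rewrite /dcoef mcoeffD mulrDr. Qed.

Lemma dcoefZ a G w : dcoef (a *: G) w = a * dcoef G w.
Proof. by rewrite /dcoef mcoeffZ mulrCA. Qed.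

Lemma dcoefX v w : dcoef 'X_[v] w = (mfact v)%:R * (v == w)%:R.
Proof. by rewrite /dcoef mcoeffX; case: eqP => [->|]; rewrite ?mulr0. Qed.

Lemma dcoef_sum (I : Type) (r : seq I) (P : pred I) f w :
  dcoef (\sum_(i <- r | P i) f i) w = \sum_(i <- r | P i) dcoef (f i) w.
Proof.
exact: (big_morph (dcoef^~ w) (fun G H => dcoefD G H w) (dcoef0 w)).
Qed.

Lemma dcoef_mderivm v G w : dcoef G^`M[v] w = dcoef G (v + w)%MM.
Proof.
rewrite /dcoef mcoeff_mderivm mulrnAr -mulrnAl -mulrnA; congr (_%:R * _).
rewrite /mfact -big_split /=; apply: eq_bigr => i _.
by rewrite mnmDE -[in RHS](@ffact_fact _ (v i)) ?leq_addr // addKn mulnC.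
Qed.

Lemma dcoef_apolar k p G w : (msize p <= k)%N ->
  dcoef (apolar p G) w
  = \sum_(m : 'X_{1..n < k}) p@_m * dcoef G (m + w)%MM.
Proof.
move=> lepk; rewrite (apolarwE _ lepk) dcoef_sum; apply: eq_bigr => m _.
by rewrite dcoefZ dcoef_mderivm.
Qed.

Lemma dcoef_homog d F w : F \is d.-homog -> dcoef F w != 0 -> mdeg w = d.
Proof.
move=> homF; rewrite dcoef_eq0; apply: contraNeq => neq.
by apply/eqP; apply: dhomog_nemf_coeff homF _.
Qed.

Lemma dcoef_apolar_homog i d p F w : p \is i.-homog -> F \is d.-homog ->
  dcoef (apolar p F) w != 0 -> (i + mdeg w)%N = d.
Proof.
move=> homp homF; rewrite (dcoef_apolar _ _ (leqnn _)) => nz.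
have /existsP[m] : [exists m : 'X_{1..n < msize p},
    p@_m * dcoef F (m + w)%MM != 0].
  apply: contraNT nz; rewrite negb_exists => /forallP z.
  by rewrite big1 // => m _; rewrite (eqP (negbNE (z m))).
rewrite mulf_eq0 negb_or => /andP[pm /(dcoef_homog homF) <-].
rewrite mdegD; congr (_ + _)%N; apply/esym/eqP.
by apply: contraNT pm => /(dhomog_nemf_coeff homp) ->.
Qed.

Lemma monomial_homog d v :
  ('X_[v] \is [in K[n], d.-homog]) = (mdeg v == d).
Proof. exact: dhomogX. Qed.

Lemma apolarC p q G : apolar p (apolar q G) = apolar q (apolar p G).
Proof. by rewrite -!apolarM mulrC. Qed.

Lemma apolarBl p q G : apolar (p - q) G = apolar p G - apolar q G.
Proof. by rewrite -scaleN1r apolarDl apolarZl scaleN1r. Qed.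

(* The perfect pairing between complementary degrees of A_F turns surjectivity
   of a multiplication map into injectivity of the dual one. *)
Lemma apolar_surj_of_inj d i k u F q :
  F \is d.-homog -> u \is k.-homog -> (i + k <= d)%N -> q \is (i + k).-homog ->
  (forall p, p \is (d - (i + k)).-homog ->
     apolar (u * p) F = 0 -> apolar p F = 0) ->
  exists2 p, p \is i.-homog & apolar (u * p) F = apolar q F.
Proof.
move=> homF homu le_ikd homq inj.
have homum m : mdeg m = i -> u * 'X_[m] \is (k + i).-homog.
  by move=> degm; apply: dhomogM; rewrite // monomial_homog degm.
pose I := 'X_{1..n < d.+1}.
pose A (m v : I) := if mdeg m == i then dcoef (apolar (u * 'X_[m]) F) v else 0.
pose b (v : I) := dcoef (apolar q F) v.
have [y yA0|z bE] := @fin_row_span K I I A b.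
  (* A functional [y] killing the image becomes a form [py] of the complementary degree; evaluating
     [y] means taking the constant term after [py] has acted. *)
  pose j := (d - (i + k))%N.
  pose py := \sum_(v : I | mdeg v == j) y v *: 'X_[v].
  have hompy : py \is j.-homog.
    by apply: rpred_sum => v /eqP degv; rewrite rpredZ // monomial_homog degv.
  have pairE G : (forall w, dcoef G w != 0 -> mdeg w = j) ->
      \sum_(v : I) dcoef G v * y v = dcoef (apolar py G) 0%MM.
    move=> homG; rewrite /py apolar_suml dcoef_sum [RHS]big_mkcond /=.
    apply: eq_bigr => v _; case: eqP => [_|nev].
      by rewrite apolarZl dcoefZ apolarX dcoef_mderivm addm0 mulrC.
    have [->|/homG //] := eqVneq (dcoef G v) 0; by rewrite mul0r.
  have py0 : apolar py F = 0.
    (* The coefficient of [(u py) o F] at [m] is the value of [y] on [(u X^m) o F], hence zero. *)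
    apply: inj => //; apply: dcoefP => m; rewrite dcoef0.
    apply/eqP/negPn/negP => nz.
    have degm : (k + j + mdeg m)%N = d.
      by apply: dcoef_apolar_homog nz => //; apply: dhomogM.
    have degmi : mdeg m = i by lia.
    have ltm : (mdeg m < d.+1)%N by lia.
    case/negP: nz; apply/eqP; rewrite -[RHS](yA0 (BMultinom ltm)).
    under eq_bigr => v _ do rewrite /A /= degmi eqxx.
    rewrite pairE; last first.
      by move=> w /(dcoef_apolar_homog (homum _ degmi) homF); lia.
    rewrite -apolarM -{1}[m]addm0 -dcoef_mderivm -apolarX -apolarM.
    by congr (dcoef (apolar _ F) _); ring.
  rewrite pairE; first by rewrite apolarC py0 apolar0r dcoef0.
  by move=> w /(dcoef_apolar_homog homq homF); rewrite /j; lia.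
exists (\sum_(m : I | mdeg m == i) z m *: 'X_[m]).
  by apply: rpred_sum => v /eqP degv; rewrite rpredZ // monomial_homog degv.
have sumE w : dcoef (apolar (u * (\sum_(m : I | mdeg m == i) z m *: 'X_[m])) F) w
    = \sum_(m : I | mdeg m == i) z m * dcoef (apolar (u * 'X_[m]) F) w.
  rewrite mulr_sumr apolar_suml dcoef_sum; apply: eq_bigr => m _.
  by rewrite -scalerAr apolarZl dcoefZ.
apply: dcoefP => w; have [ltw|gew] := ltnP (mdeg w) d.+1.
  rewrite sumE -[RHS]/(b (BMultinom ltw)) bE big_mkcond /=.
  by apply: eq_bigr => m _; rewrite /A; case: ifP; rewrite ?mulr0.
rewrite sumE [RHS](_ : _ = 0).
  rewrite big1 // => m /eqP degm.
  have [->|] := eqVneq (dcoef (apolar (u * 'X_[m]) F) w) 0; first by rewrite mulr0.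
  by move/(dcoef_apolar_homog (homum _ degm) homF); lia.
apply/eqP/negPn/negP => /(dcoef_apolar_homog homq homF); lia.
Qed.

(** * Lefschetz properties of [A_F] from injectivity up to the middle degree *)

Section Quotient.

Variables (d : nat) (F : {mpoly K[n]}) (nzF : F != 0).
Hypothesis homF : F \is d.-homog.

Local Open Scope quotient_scope.
Local Notation cls := (\pi_{ideal_quot (Ann nzF)}).

Lemma gorenstein_eqP p q : reflect (apolar p F = apolar q F) (cls p == cls q).
Proof.
have -> : (cls p == cls q) = (p - q \in Ann nzF).
  by rewrite Quotient.idealrBE.
rewrite inE apolarBl subr_eq0; exact: eqP.
Qed.

Lemma clsM p q : cls (p * q) = cls p * cls q :> gorenstein nzF.
Proof. exact: rmorphM. Qed.

Lemma clsX p k : cls (p ^+ k) = (cls p : gorenstein nzF) ^+ k.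
Proof. exact: rmorphXn. Qed.

Lemma gorenstein_mul_injective i u :
  (forall p, p \is i.-homog -> apolar (u * p) F = 0 -> apolar p F = 0) ->
  mul_injective (@gorenstein_comp K n F nzF) i (cls u : gorenstein nzF).
Proof.
move=> inj _ _ [p homp ->] [q homq ->]; rewrite -!clsM => /eqP/gorenstein_eqP eq_upq.
apply/eqP/gorenstein_eqP/eqP; rewrite -subr_eq0 -apolarBl; apply/eqP.
apply: inj; first exact: rpredB.
by rewrite mulrBr apolarBl eq_upq subrr.
Qed.

Lemma gorenstein_mul_surjective i k u : u \is k.-homog ->
  ((i + k <= d)%N -> forall p, p \is (d - (i + k)).-homog ->
     apolar (u * p) F = 0 -> apolar p F = 0) ->
  mul_surjective (@gorenstein_comp K n F nzF) i (i + k)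
    (cls u : gorenstein nzF).
Proof.
move=> homu inj _ [q homq ->]; have [le_ikd|gt_ikd] := leqP (i + k)%N d.
  have [p homp eq_upq] := apolar_surj_of_inj homF homu le_ikd homq (inj le_ikd).
  exists (cls p : gorenstein nzF); first by exists p.
  by rewrite -clsM; apply/eqP/gorenstein_eqP.
(* Beyond the socle degree [d] the target component is zero. *)
exists (0 : gorenstein nzF).
  by exists 0; [apply: rpred0 | rewrite rmorph0].
rewrite mulr0 -(rmorph0 cls); apply/eqP/gorenstein_eqP.
rewrite apolar0l; apply/esym/dcoefP => w; rewrite dcoef0.
apply/eqP/negPn/negP => /(dcoef_apolar_homog homq homF); lia.
Qed.

(** Injectivity of a power of [l] passes to lower powers. When [2i + k > d], duality asks for
    injectivity of [l^k] in degree [d - (i + k)], which the same hypothesis covers. *)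
Lemma SLP_of_inj l : l \is 1.-homog ->
  (forall i p, (2 * i <= d)%N -> p \is i.-homog ->
     apolar (l ^+ (d - 2 * i) * p) F = 0 -> apolar p F = 0) ->
  has_SLP nzF.
Proof.
move=> homl inj.
have inj' i k p : (2 * i + k <= d)%N -> p \is i.-homog ->
    apolar (l ^+ k * p) F = 0 -> apolar p F = 0.
  move=> le_d homp lp0; apply: (inj i p) => //; first by lia.
  rewrite (_ : d - 2 * i = (d - 2 * i - k) + k)%N; last by lia.
  by rewrite exprD -mulrA apolarM lp0 apolar0r.
exists (cls l : gorenstein nzF) => [|i k _]; first by exists l.
rewrite -clsX; have homlk : l ^+ k \is k.-homog.
  by rewrite -[X in X.-homog]mul1n; apply: dhomogMn.
have [le_d|gt_d] := leqP (2 * i + k)%N d; [left|right].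
  by apply: gorenstein_mul_injective => p; apply: inj'.
apply: gorenstein_mul_surjective => // le_ikd p; apply: inj'; lia.
Qed.

Lemma WLP_of_inj l : l \is 1.-homog ->
  (forall i p, (2 * i < d)%N -> p \is i.-homog ->
     apolar (l * p) F = 0 -> apolar p F = 0) ->
  has_WLP nzF.
Proof.
move=> homl inj; exists (cls l : gorenstein nzF) => [|i]; first by exists l.
have [lt_d|ge_d] := ltnP (2 * i)%N d; [left|right].
  by apply: gorenstein_mul_injective => p; apply: inj.
rewrite -addn1; apply: gorenstein_mul_surjective => // le_d p; apply: inj; lia.
Qed.

End Quotient.

Lemma WLP_of_SLP F (nzF : F != 0) : has_SLP nzF -> has_WLP nzF.
Proof.
case=> l hom_l rank_l; exists l => // i.
by have := rank_l i 1%N isT; rewrite addn1 expr1.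
Qed.

End Apolarity.

(** * Lefschetz elements for binomials *)

Section BinomialLefschetz.

Variables (K : fieldType) (n : nat).
Hypothesis charK0 : [pchar K] =i pred0.
Implicit Types (p q F G : {mpoly K[n]}) (v w e : 'X_{1..n}).

Lemma dcoef_apolarX p e w : dcoef (apolar p 'X_[e]) w
  = (mfact e)%:R * (if (w <= e)%MM then p@_(e - w) else 0).
Proof.
pose k := maxn (msize p) (mdeg e).+1.
rewrite (@dcoef_apolar _ _ k) ?leq_maxl //; under eq_bigr => m _ do rewrite dcoefX.
case: ifP => [le_we|nle_we]; last first.
  rewrite mulr0 big1 // => m _; case: eqP => [eE|]; rewrite ?mulr0 //.
  by rewrite eE lem_addl in nle_we.
have lt_k : (mdeg (e - w) < k)%N.
  by rewrite (leq_trans _ (leq_maxr _ _)) // ltnS -[in mdeg e](submK le_we) mdegD leq_addr.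
rewrite (bigD1 (BMultinom lt_k)) //= submK // eqxx mulr1 big1 ?addr0 1?mulrC //.
move=> m nem; rewrite (_ : (e == (m + w)%MM) = false) ?mulr0 //.
apply: contraNF nem => /eqP eE; apply/eqP/val_inj => /=.
by rewrite eE addmK.
Qed.

Definition weighted_form (x : 'I_n) (t : K) : {mpoly K[n]} :=
  \sum_(j < n) (if j == x then t else 1) *: 'X_j.

Lemma weighted_form_homog x t : weighted_form x t \is 1.-homog.
Proof. by apply: rpred_sum => j _; rewrite rpredZ // monomial_homog mdeg1. Qed.

(* Putting the weight on the functions rather than on the linear form lets the
   same operator [lower] serve for all the forms [weighted_form x t]. *)
Definition weighted_dcoef (x : 'I_n) (t : K) G w : K := t ^+ w x * dcoef G w.

Lemma lower_weighted_dcoef x t G v :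
  lower (weighted_dcoef x t G) v
  = weighted_dcoef x t (apolar (weighted_form x t) G) v.
Proof.
rewrite /weighted_dcoef apolar_suml dcoef_sum mulr_sumr; apply: eq_bigr => j _.
rewrite apolarZl dcoefZ apolarX dcoef_mderivm mnmDE mnm1E (addmC v).
case: (j == x) => /=; last by rewrite addn0 mul1r.
by rewrite addn1 exprSr -mulrA.
Qed.

Lemma iter_lower_weighted_dcoef x t k p G v :
  iter k (@lower K n) (weighted_dcoef x t (apolar p G)) v
  = weighted_dcoef x t (apolar (weighted_form x t ^+ k * p) G) v.
Proof.
elim: k v => [|k IHk] v; first by rewrite expr0 mul1r.
by rewrite iterS (eq_lower IHk) lower_weighted_dcoef -apolarM mulrA -exprS.
Qed.

Lemma exists_nonroot (P : {poly K}) : P != 0 -> exists t, P.[t] != 0.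
Proof.
move=> nzP; pose s := [seq (i%:R : K) | i <- iota 0 (size P)].
have inj_nat : injective (fun i : nat => (i%:R : K)).
  have aux i j : (i <= j)%N -> i%:R = j%:R :> K -> i = j.
    move=> leij /eqP; rewrite eq_sym -subr_eq0 -natrB // (pcharf0P K).1 //; lia.
  move=> i j eqij; have [/aux->//|/ltnW/aux] := leqP i j; by move=> ->.
have uniq_s : uniq s by rewrite map_inj_uniq ?iota_uniq.
have /allPn[t _ nrt] : ~~ all (root P) s.
  apply/negP => /(max_poly_roots nzP) /(_ uniq_s).
  by rewrite size_map size_iota ltnn.
by exists t.
Qed.

(** A product of polynomials controls all degrees [i] at once, so that a single linear form serves
    them all. *)
Lemma common_nonvanishing (Q : nat -> K -> Prop) m :
  (forall i, (i < m)%N -> exists2 D : {poly K}, D.[0] != 0 &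
     forall tau, D.[tau] != 0 -> Q i tau) ->
  exists2 D : {poly K}, D.[0] != 0 &
    forall tau, D.[tau] != 0 -> forall i, (i < m)%N -> Q i tau.
Proof.
elim: m => [|m IHm] H; first by exists 1; rewrite ?hornerC ?oner_neq0.
have [i lt_im|D D0 DQ] := IHm; first by apply: H; apply: ltnW.
have [E E0 EQ] := H m (ltnSn m).
exists (D * E) => [|tau]; rewrite hornerM mulf_eq0 negb_or; first by rewrite D0.
case/andP=> Dtau Etau i; rewrite ltnS leq_eqVlt => /predU1P[->|lt_im]; first exact: EQ.
exact: DQ.
Qed.

(** The weighted coefficients of [p o F] take the form [c - tau shift c] with [c] of standard
    support, and [generic_standard_inj] yields [c = 0]. *)
Lemma binomial_lefschetz_form (x : 'I_n) (e1 e2 : 'X_{1..n}) (k1 k2 : K) :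
  (forall j, j != x -> (e1 j <= e2 j)%N) -> mdeg e1 = mdeg e2 -> e1 != e2 ->
  k2 != 0 ->
  exists2 l : {mpoly K[n]}, l \is 1.-homog &
    forall i p, (2 * i <= mdeg e1)%N -> p \is i.-homog ->
      apolar (l ^+ (mdeg e1 - 2 * i) * p) (k1 *: 'X_[e1] + k2 *: 'X_[e2]) = 0 ->
      apolar p (k1 *: 'X_[e1] + k2 *: 'X_[e2]) = 0.
Proof.
move=> le12 deg12 neq12 nzk2; set d := mdeg e1; set F := _ + _.
have gt0 := binomial_x_lt le12 deg12 neq12.
(* Minus the ratio of the divided power coefficients of the two monomials; the weights contribute a
   further [t^pp], since [shift] moves the [X_x]-degree by [pp]. *)
pose a := - (k1 * (mfact e1)%:R) / (k2 * (mfact e2)%:R).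
have nzk2' : k2 * (mfact e2)%:R != 0 by rewrite mulf_neq0 ?mfact_neq0.
pose pp := (e1 x - e2 x)%N.
have pp_gt0 : (0 < pp)%N by rewrite subn_gt0.
have [i lt_i|D D0 DQ] := @common_nonvanishing (fun i tau => forall c,
    supp_deg (d - i) c -> (forall w, c w != 0 -> standard x e1 e2 w) ->
    iter (d - 2 * i) (@lower K n) (fun w => c w - tau * shift x e1 e2 c w)
      =1 (fun=> 0) -> c =1 (fun=> 0)) (d %/ 2).+1.
  apply: generic_standard_inj => //; rewrite -/d.
  by move: lt_i; rewrite ltnS leq_divRL //; lia.
(* The factor ['X] forces [t != 0], so that the weights can be cancelled at the end. *)
have [|t] := @exists_nonroot ('X * (D \Po (a *: 'X^pp))).
  rewrite mulf_neq0 ?polyX_eq0 //; apply: contraNneq D0 => D0.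
  have := horner_comp D (a *: 'X^pp) 0.
  by rewrite D0 hornerE hornerZ hornerXn expr0n gtn_eqF // mulr0 => <-.
rewrite hornerM hornerX mulf_eq0 negb_or horner_comp hornerZ hornerXn.
set tau := a * t ^+ pp => /andP[nzt /DQ {}DQ].
exists (weighted_form x t); first exact: weighted_form_homog.
move=> i p le_i homp lp0; pose r := (d - i)%N.
have degP e w : mdeg e = d -> (w <= e)%MM -> p@_(e - w) != 0 -> mdeg w = r.
  move=> dege le_we nz; have : mdeg (e - w) = i.
    by apply/eqP; apply: contraNT nz => /(dhomog_nemf_coeff homp) ->.
  by rewrite /r -dege -[in mdeg e](submK le_we) mdegD => ->; rewrite addKn.
pose g := weighted_dcoef x t (apolar p F).
pose c1 w := t ^+ w x * (k2 * (mfact e2)%:R)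
  * (if (w <= e2)%MM then p@_(e2 - w) else 0).
pose f1 w := t ^+ w x * (k1 * (mfact e1)%:R)
  * (if (w <= e1)%MM then p@_(e1 - w) else 0).
(* Below [X_x]-degree [pp], [f1] is out of reach of [shift]; this part gets its own resolution
   [c2]. *)
pose f w := if (w x < pp)%N then f1 w else 0.
have gE w : g w = f1 w + c1 w.
  rewrite /g /weighted_dcoef /f1 /c1 -!mulrA -mulrDr -!dcoef_apolarX; congr (_ * _).
  rewrite !(@dcoef_apolar _ _ (msize p)) // !mulr_sumr -big_split /=.
  by apply: eq_bigr => m _; rewrite dcoefD !dcoefZ; ring.
have f1E w : (pp <= w x)%N -> f1 w = - (tau * shift x e1 e2 c1 w).
  move=> le_w; rewrite /shift le_w /=; have [le_we|gt_we] := leqP (w x) (e1 x).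
    rewrite /c1 mnmDE mnmBE (N_x le12 deg12 neq12) addn0.
    have w12 : (w x - (e1 - e2)%MM x = w x - pp)%N by rewrite mnmBE.
    rewrite w12.
    have -> : (w - (e1 - e2) + (e2 - e1) <= e2)%MM = (w <= e1)%MM.
      apply/mnm_lepP/mnm_lepP => H j; move: (H j); rewrite !(mnmDE, mnmBE).
        by have [->|/le12] := eqVneq j x; lia.
      by have [->|/le12] := eqVneq j x; rewrite -/pp; lia.
    rewrite /f1; case: ifP => [/mnm_lepP le_w1|]; last by rewrite !mulr0 oppr0.
    have -> : (e2 - (w - (e1 - e2) + (e2 - e1)) = e1 - w)%MM.
      apply/mnmP => j; rewrite !(mnmDE, mnmBE); have := le_w1 j.
      by have [->|/le12] := eqVneq j x; move: le_w; rewrite /pp; lia.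
    rewrite /tau /a -{1}(subnKC le_w) exprD; field.
    by move: nzk2'; rewrite mulf_eq0 negb_or andbC.
  rewrite mulr0 oppr0 /f1; case: ifP => [/mnm_lepP/(_ x)|]; last by rewrite mulr0.
  by rewrite leqNgt gt_we.
have degf : supp_deg r f.
  move=> w; rewrite /f /f1; case: ifP => _; last by rewrite eqxx.
  case: ifP => le_w; last by rewrite mulr0 eqxx.
  by rewrite mulf_eq0 negb_or => /andP[_]; apply: degP.
have suppf w : f w != 0 -> (w x < pp)%N && (w <= e1)%MM.
  rewrite /f /f1; case: ifP => _; last by rewrite eqxx.
  by case: ifP => // _; rewrite mulr0 eqxx.
have [c2 [degc2 stdc2 c2E]] := shift_resolution le12 deg12 neq12 tau degf suppf.
have degc1 : supp_deg r c1.
  move=> w; rewrite /c1; case: ifP => le_w; last by rewrite mulr0 eqxx.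
  by rewrite mulf_eq0 negb_or => /andP[_]; apply: degP => //; rewrite -deg12.
have stdc1 w : c1 w != 0 -> standard x e1 e2 w.
  by rewrite /c1 /standard; case: ifP => // _; rewrite mulr0 eqxx.
pose c w := c1 w + c2 w.
have cN w : c w != 0 -> c1 w != 0 \/ c2 w != 0.
  rewrite /c; have [->|] := eqVneq (c1 w) 0; last by left.
  by rewrite add0r; right.
have shiftc w : shift x e1 e2 c w = shift x e1 e2 c1 w + shift x e1 e2 c2 w.
  by rewrite /shift; case: ifP => _ //; rewrite addr0.
have cg w : c w - tau * shift x e1 e2 c w = g w.
  rewrite shiftc gE /c mulrDr opprD addrACA c2E addrC; rewrite /f.
  case: ltnP => [lt_w|ge_w]; last by rewrite (f1E _ ge_w) add0r addrC.
  rewrite [shift _ _ _ c1 w]/shift leqNgt lt_w /= mulr0 subr0.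
  by [].
have c0 : c =1 (fun=> 0).
  apply: (DQ i) => //.
  - by rewrite ltnS leq_divRL // mulnC.
  - by move=> w /cN[/degc1|/degc2].
  - by move=> w /cN[/stdc1|/stdc2].
  move=> w; rewrite (eq_iter_lower _ cg) iter_lower_weighted_dcoef lp0.
  by rewrite /weighted_dcoef dcoef0 mulr0.
apply: dcoefP => // w; rewrite dcoef0.
have : g w = 0.
  by rewrite -cg c0 /shift c0; case: ifP => _; rewrite mulr0 subr0.
by move/eqP; rewrite mulf_eq0 expf_eq0 (negPf nzt) andbF => /eqP.
Qed.

Lemma binomial_SLP (x : 'I_n) (e1 e2 : 'X_{1..n}) (k1 k2 : K) F
    (nzF : F != 0) :
  F = k1 *: 'X_[e1] + k2 *: 'X_[e2] ->
  (forall j, j != x -> (e1 j <= e2 j)%N) -> mdeg e1 = mdeg e2 -> e1 != e2 ->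
  k2 != 0 -> has_SLP nzF.
Proof.
move=> FE le12 deg12 neq12 nzk2.
have [l homl inj] := binomial_lefschetz_form k1 le12 deg12 neq12 nzk2.
have homF : F \is (mdeg e1).-homog.
  by rewrite FE; apply: rpredD; rewrite rpredZ // monomial_homog ?deg12.
by apply: (SLP_of_inj charK0 nzF homF homl) => i p; rewrite FE; apply: inj.
Qed.

Lemma binomial_diff_SLP (x : 'I_n) (e1 e2 : 'X_{1..n}) F (nzF : F != 0) :
  F = 'X_[e1] - 'X_[e2] -> mdeg e1 = mdeg e2 ->
  (forall j, j != x -> (e1 j <= e2 j)%N) \/
  (forall j, j != x -> (e2 j <= e1 j)%N) -> has_SLP nzF.
Proof.
move=> FE deg12 le; have neq12 : e1 != e2.
  by apply: contraNneq nzF => e12; rewrite FE e12 subrr.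
case: le => le12.
  by apply: (@binomial_SLP x e1 e2 1 (-1)); rewrite ?oppr_eq0 ?oner_neq0 // scale1r scaleN1r.
apply: (@binomial_SLP x e2 e1 (-1) 1); rewrite ?oner_neq0 1?eq_sym //.
by rewrite scale1r scaleN1r addrC.
Qed.

Lemma WLP_of_high_exponent (x : 'I_n) (a d : nat) F (nzF : F != 0) :
  F \is d.-homog -> (forall w, dcoef F w != 0 -> (a <= w x)%N) ->
  (d < 2 * a)%N -> has_WLP nzF.
Proof.
move=> homF highF lt_da.
apply: (WLP_of_inj charK0 nzF homF (l := 'X_x)); first by rewrite monomial_homog mdeg1.
move=> i p lt_id homp xp0; apply: dcoefP => // w; rewrite dcoef0.
(* If [w x > 0], the coefficient at [w] is also one of [(X_x p) o F]. If [w x = 0], a nonzero term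
   needs [a <= m x <= i], against [2i < d < 2a]. *)
have [w0|w_gt0] := posnP (w x); last first.
  have le_xw : (U_(x) <= w)%MM by rewrite lep1mP -lt0n.
  by rewrite -(submK le_xw) addmC -dcoef_mderivm -apolarX -apolarM xp0 dcoef0.
rewrite (dcoef_apolar _ _ (leqnn _)) big1 // => m _.
have [->|nzm] := eqVneq p@_m 0; first by rewrite mul0r.
have [->|/highF] := eqVneq (dcoef F (m + w)%MM) 0; first by rewrite mulr0.
have degm : mdeg m = i.
  by apply/eqP; apply: contraNT nzm => /(dhomog_nemf_coeff homp) ->.
rewrite mnmDE w0 addn0 => le_am; have : (m x <= mdeg m)%N.
  by rewrite mdegE (bigD1 x) //= leq_addr.
by rewrite degm; lia.
Qed.

End BinomialLefschetz.

(** * Translation of the four families into binomials *)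

Lemma mpolyX_partial (R : nzRingType) n (P : pred 'I_n) (b : 'I_n -> nat) :
  'X_[[multinom if P i then b i else 0%N | i < n]]
  = \prod_(i < n | P i) 'X_i ^+ b i :> {mpoly R[n]}.
Proof.
rewrite mpolyXE_id [RHS]big_mkcond /=; apply: eq_bigr => i _.
by rewrite mnmE; case: (P i).
Qed.

Lemma mdeg_partial n (P : pred 'I_n) (b : 'I_n -> nat) :
  mdeg [multinom if P i then b i else 0%N | i < n] = (\sum_(i < n | P i) b i)%N.
Proof.
by rewrite mdegE [RHS]big_mkcond /=; apply: eq_bigr => i _; rewrite mnmE.
Qed.

Theorem mainTheorem1 (K : fieldType) (charK0 : [pchar K] =i pred0)
    (n : nat) (n_ge2 : (2 <= n)%N) (a b c : 'I_n -> nat) (m : nat) :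
  let i1 := ord_1st n_ge2 in
  let i2 := ord_2nd n_ge2 in
  [/\ (* (1) *)
      forall r : nat, (1 <= r <= n - 1)%N ->
        (\sum_(i < n | (i < r)%N) b i = \sum_(i < n | (r <= i)%N) b i)%N ->
        (\sum_(i < n | i != i1) a i + \sum_(i < n | (r <= i)%N) b i < a i1)%N ->
        let F : {mpoly K[n]} :=
          (\prod_(i < n) 'X_i ^+ a i) *
          (\prod_(i < n | (i < r)%N) 'X_i ^+ b i
           - \prod_(i < n | (r <= i)%N) 'X_i ^+ b i) in
        forall nzF : F != 0, has_WLP nzF,
      (* (2) *)
      forall i : 'I_n,
        (\sum_(j < n | j != i1) b j = b i1)%N ->
        let F : {mpoly K[n]} :=
          'X_i ^+ a i * ('X_i1 ^+ b i1 - \prod_(j < n | j != i1) 'X_j ^+ b j) in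
        forall nzF : F != 0, has_WLP nzF,
      (* (3) *)
      let F : {mpoly K[n]} :=
        (\prod_(i < n) 'X_i ^+ c i) * ('X_i1 ^+ m - 'X_i2 ^+ m) in
      forall nzF : F != 0, has_SLP nzF
    & (* (4) *)
      (3 <= n)%N ->
      forall (i j r : 'I_n) (m1 m2 : 'X_{1..n}),
        uniq [:: i; j; r] ->
        (forall k : 'I_n, k \notin [:: i; j; r] -> m1 k = 0%N /\ m2 k = 0%N) ->
        mdeg m1 = mdeg m2 ->
        let F : {mpoly K[n]} :=
          (\prod_(k < n) 'X_k ^+ c k) * ('X_[m1] - 'X_[m2]) in
        forall nzF : F != 0, has_SLP nzF].
Proof.
move=> i1 i2; split.
- move=> r _ degb gt_a F nzF.
  pose A := [multinom a i | i < n].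
  pose B1 := [multinom if (i < r)%N then b i else 0%N | i < n].
  pose B2 := [multinom if (r <= i)%N then b i else 0%N | i < n].
  have FE : F = 'X_[A + B1] - 'X_[A + B2].
    rewrite !mpolyXD -mulrBr /F; congr (_ * (_ - _)).
    - by rewrite mpolyXE_id; apply: eq_bigr => i _; rewrite mnmE.
    - by rewrite -mpolyX_partial.
    by rewrite -mpolyX_partial.
  have degB1 : mdeg B1 = (\sum_(i < n | (r <= i)%N) b i)%N by rewrite mdeg_partial.
  have degB2 : mdeg B2 = mdeg B1 by rewrite degB1 mdeg_partial.
  apply: (WLP_of_high_exponent (x := i1) (a := a i1) (d := mdeg (A + B1)) charK0).
  + rewrite FE; apply: rpredB; rewrite monomial_homog //.
    by rewrite !mdegD degB2.
  + move=> w; rewrite FE dcoef_eq0 // mcoeffB !mcoeffX.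
    have [<-|_] := eqVneq (A + B1)%MM w; first by rewrite mnmDE mnmE leq_addr.
    have [<-|_] := eqVneq (A + B2)%MM w; first by rewrite mnmDE mnmE leq_addr.
    by rewrite subr0 eqxx.
  (* The degree is counted with the [b i] for [r <= i], the sum bounded by hypothesis. *)
  rewrite mdegD degB1 mdegE (eq_bigr a) => [|i _]; last exact: mnmE.
  by rewrite (bigD1 i1) //= mul2n -addnn -addnA ltn_add2l.
- move=> i degb F nzF.
  pose B := [multinom if j != i1 then b j else 0%N | j < n].
  apply: WLP_of_SLP; apply: (@binomial_diff_SLP _ _ charK0 i1
    (U_(i) *+ a i + U_(i1) *+ b i1)%MM (U_(i) *+ a i + B)%MM).
  + rewrite !mpolyXD -mulrBr -!mpolyXn /F; congr (_ * (_ - _)).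
    by rewrite -mpolyX_partial.
  + by rewrite !mdegD !mdegMn !mdeg1 mdeg_partial degb !mul1n.
  (* Apart from [X_1], the first exponent is that of the common factor alone. *)
  left=> j nej; rewrite !mnmDE leq_add2l mulmnE mnm1E eq_sym (negPf nej).
  by rewrite mul0n.
- move=> F nzF; pose C := [multinom c i | i < n].
  apply: (@binomial_diff_SLP _ _ charK0 i1 (C + U_(i1) *+ m)%MM
    (C + U_(i2) *+ m)%MM).
  + rewrite !mpolyXD -mulrBr -!mpolyXn /F; congr (_ * _).
    by rewrite mpolyXE_id; apply: eq_bigr => i _; rewrite mnmE.
  + by rewrite !mdegD !mdegMn !mdeg1.
  left=> j nej; rewrite !mnmDE leq_add2l !mulmnE !mnm1E (eq_sym i1).
  by rewrite (negPf nej) mul0n.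
move=> _ i j r m1 m2 _ out_ijr deg12 F nzF.
pose C := [multinom c k | k < n].
have FE : F = 'X_[C + m1] - 'X_[C + m2].
  rewrite !mpolyXD -mulrBr /F; congr (_ * _).
  by rewrite mpolyXE_id; apply: eq_bigr => k _; rewrite mnmE.
(* Among the three comparisons of exponents, two go the same way. *)
have [x le12] : exists x, (forall k, k != x -> (m1 k <= m2 k)%N) \/
                          (forall k, k != x -> (m2 k <= m1 k)%N).
  (* Here [x] is the index whose comparison may go the other way. *)
  have in3 (P : 'I_n -> Prop) x y z : perm_eq [:: x; y; z] [:: i; j; r] ->
      (forall k, k \notin [:: i; j; r] -> P k) -> P y -> P z ->
      forall k, k != x -> P k.
    move=> /perm_mem eqm Pout Py Pz k nekx.
    have [|/Pout //] := boolP (k \in [:: i; j; r]).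
    by rewrite -eqm !inE (negPf nekx) /= => /orP[] /eqP ->.
  have out1 k : k \notin [:: i; j; r] -> (m1 k <= m2 k)%N.
    by case/out_ijr => m1k0 m2k0; rewrite m1k0 m2k0.
  have out2 k : k \notin [:: i; j; r] -> (m2 k <= m1 k)%N.
    by case/out_ijr => m1k0 m2k0; rewrite m1k0 m2k0.
  have perm_j : perm_eq [:: j; i; r] [:: i; j; r].
    by apply/permP => P /=; rewrite !addnA (addnC (P j)).
  have perm_r : perm_eq [:: r; i; j] [:: i; j; r].
    by rewrite -(perm_rot 1).
  have [lei|/ltnW lei] := leqP (m1 i) (m2 i);
  have [lej|/ltnW lej] := leqP (m1 j) (m2 j);
  have [ler|/ltnW ler] := leqP (m1 r) (m2 r);
    first [ by exists i; left; apply: (in3 (fun k => m1 k <= m2 k)%N i j r)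
          | by exists j; left; apply: (in3 (fun k => m1 k <= m2 k)%N j i r)
          | by exists r; left; apply: (in3 (fun k => m1 k <= m2 k)%N r i j)
          | by exists i; right; apply: (in3 (fun k => m2 k <= m1 k)%N i j r)
          | by exists j; right; apply: (in3 (fun k => m2 k <= m1 k)%N j i r)
          | by exists r; right; apply: (in3 (fun k => m2 k <= m1 k)%N r i j) ].
apply: (@binomial_diff_SLP _ _ charK0 x _ _ _ nzF FE); first by rewrite !mdegD deg12.
by case: le12 => le; [left|right] => k /le; rewrite !mnmDE leq_add2l.
Qed.
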